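(* Let $q$ be a prime power and let $p(x)\in \mathbb{F}_q[x]$ be a monic irreducible polynomial of degree $k\geq 1$ with $p(1)\neq 0$. Let $m=q^k-1$ and define the rational function $g(x)=\dfrac{x^m-1}{(x-1)\,p(x)}$. Then $p(x)$ is primitive if and only if $g(x)$ is a polynomial with exactly $(q-1)q^{k-1}-1$ nonzero coefficients.
   Context: $\mathbb{F}_q$ denotes the finite field with $q$ elements. A polynomial $p(x)\in\mathbb{F}_q[x]$ of degree $k$ is called primitive if it is irreducible over $\mathbb{F}_q$, $p(0)\neq 0$, and a root of $p(x)$ in $\mathbb{F}_{q^k}$ has multiplicative order $q^k-1$, i.e. generates the cyclic group $\mathbb{F}_{q^k}^*$. The number of nonzero terms of a polynomial means the number of its nonzero coefficients. *)

(* Defs.v *)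
From HB Require Import structures.
From mathcomp Require Import all_boot all_order all_algebra all_field.

Set Implicit Arguments.
Unset Strict Implicit.
Unset Printing Implicit Defensive.

Import GRing.Theory.
Local Open Scope ring_scope.

(* The degree-k extension L of F is the field with #|F| ^ k elements. Such an L
   is unique up to isomorphism, and the roots in L of an irreducible p are
   conjugate over F, so the property does not depend on the chosen L and a.
   (qfpoly.primitive_poly is instead phrased by divisibility of 'X^n - 1 by p,
   and also requires p to be monic.) *)
Definition root_primitive_poly (F : finFieldType) (p : {poly F}) : Prop :=
  let k := (size p).-1 in
  [/\ irreducible_poly p,
      p.[0] != 0
    & exists (L : fieldExtType F) (a : L),
        [/\ \dim {:L} = k,
            root (map_poly (in_alg L) p) a
          & (#|F| ^ k - 1)%N.-primitive_root a]].

Definition nb_nonzero_coefs (F : fieldType) (p : {poly F}) : nat :=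
  count (fun c => c != 0) p.

(* Main.v *)
(** Put [m = q^k - 1] and [h = (X^m - 1) / ((X - 1) p)]. Subtracting
    [(1 + X + ... + X^(m-1)) / p(1)] from [h] gives a multiple [h'] of
    [(X^m - 1) / p] modulo [X^m - 1], so the coefficients of [h'] are the values
    of a linear form on [F[X]/(p)] at the powers of [X]. When [p] is primitive
    these powers run over all nonzero residues; the coefficient of [h] vanishes
    where the nonzero form takes the nonzero value [-1/p(1)], that is [q^(k-1)]
    times. When the root has order [n < m], the coefficients of [h] are
    [n]-periodic and [m/n] divides their weight, which is incompatible with the
    weight [m - q^(k-1)] because [m/n] is coprime to [q]. *)
Require Import Defs.
From HB Require Import structures.
From mathcomp Require Import all_boot all_order all_algebra all_field.

Set Implicit Arguments.
Unset Strict Implicit.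
Unset Printing Implicit Defensive.

Import GRing.Theory.
Local Open Scope ring_scope.

(** * Counting nonzero coefficients *)

Lemma nb_nonzero_coefsE {F : fieldType} (p : {poly F}) (n : nat) :
  (size p <= n)%N -> nb_nonzero_coefs p = (\sum_(i < n) (p`_i != 0)%R)%N.
Proof.
move=> le_pn; rewrite /nb_nonzero_coefs -sum1_count big_mkcond (big_nth 0) /=.
rewrite -(big_mkord xpredT (fun i => nat_of_bool (p`_i != 0))).
rewrite [RHS](big_cat_nat (n := size p)) //= [X in (_ + X)%N]big_nat_cond.
rewrite [X in (_ + X)%N]big1 ?addn0; first by apply: eq_bigr => i _; case: eqP.
by move=> i /andP[/andP[le_pi _] _]; rewrite nth_default ?eqxx.
Qed.

Lemma nb_nonzero_coefs_card {F : fieldType} (p : {poly F}) (n : nat) :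
  (size p <= n)%N ->
  (nb_nonzero_coefs p + #|[set i : 'I_n | (p`_i == 0)%R]| = n)%N.
Proof.
move=> le_pn; rewrite (nb_nonzero_coefsE le_pn) -sum1dep_card.
rewrite [X in (_ + X)%N]big_mkcond.
rewrite -big_split /= -[RHS]card_ord -sum1_card; apply: eq_bigr => i _.
by case: eqP.
Qed.

Lemma size_mul_geometric {F : fieldType} (u : {poly F}) (n d : nat) :
  (size u <= n)%N -> (size (u * \sum_(i < d) ('X^n) ^+ i)%R <= d * n)%N.
Proof.
move=> le_un; elim: d => [|d IHd]; first by rewrite big_ord0 mulr0 size_poly0.
rewrite big_ord_recl expr0 mulrDr mulr1 (leq_trans (size_polyD _ _)) //.
rewrite geq_max (leq_trans le_un) ?leq_pmull //=.
under eq_bigr do rewrite exprSr.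
rewrite -mulr_suml mulrA (leq_trans (size_polyMleq _ _)) // size_polyXn addnS /=.
by rewrite mulSnr leq_add2r.
Qed.

(** The bound on [size u] makes the [d] shifted copies of [u] occupy disjoint ranges of degrees; the
    induction splits off the lowest copy. *)
Lemma nb_nonzero_coefs_mul_geometric {F : fieldType} (u : {poly F}) (n d : nat) :
  (size u <= n)%N ->
  nb_nonzero_coefs (u * \sum_(i < d) ('X^n) ^+ i) = (d * nb_nonzero_coefs u)%N.
Proof.
move=> le_un; elim: d => [|d IHd].
  by rewrite big_ord0 mulr0 /nb_nonzero_coefs polyseq0.
rewrite (nb_nonzero_coefsE (size_mul_geometric d.+1 le_un)) mulSn.
rewrite big_split_ord /= mulSn -IHd.
rewrite (nb_nonzero_coefsE (size_mul_geometric d le_un)).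
rewrite (nb_nonzero_coefsE le_un) big_ord_recl expr0 mulrDr mulr1.
under [\sum_(i < d) _]eq_bigr do rewrite exprSr.
rewrite -mulr_suml mulrA; congr (_ + _)%N; apply: eq_bigr => i _ /=.
  by rewrite coefD coefMXn ltn_ord addr0.
rewrite coefD coefMXn ltnNge leq_addr /= addKn nth_default ?add0r //.
by rewrite (leq_trans le_un) ?leq_addr.
Qed.

(** * Linear forms and cyclic shifts *)

Lemma card_linear_fiber {F : finFieldType} {k : nat} (f : 'rV[F]_k -> F)
    (v0 : 'rV[F]_k) (a : F) :
  linear (f : _ -> F^o) -> f v0 != 0 -> (#|F| * #|[set v | f v == a]| = #|F| ^ k)%N.
Proof.
move=> flin fv0.
have fiber_card b : #|[set v | f v == b]| = #|[set v | f v == a]|.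
  (* Scaled so that [f t = b - a]: translation by [t] maps the fiber over [a] onto the fiber over
     [b]. *)
  pose t : 'rV[F]_k := ((b - a) / f v0) *: v0.
  have ft v : f (t + v) = b - a + f v by rewrite flin /= /GRing.scale /= divfK.
  rewrite -(card_imset [set v | f v == a] (addrI t)).
  apply: eq_card => v; rewrite inE; apply/eqP/imsetP => [fv | [w]].
    exists (v - t); last by rewrite addrC subrK.
    rewrite inE; apply/eqP/(addrI (b - a)).
    by rewrite -ft addrC subrK fv subrK.
  by rewrite inE => /eqP fw ->; rewrite ft fw subrK.
have := card_mx F 1 k; rewrite mul1n => <-.
rewrite -[RHS]sum1_card (partition_big f predT) //=.
under [RHS]eq_bigr => b _ do rewrite sum1dep_card fiber_card.
by rewrite sum_nat_const.
Qed.

(** Multiplying by ['X^j] modulo ['X^m - 1] is a cyclic shift, so one fixed linear form, the top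
    coefficient, reads every coefficient of [u]. *)
Lemma coef_mulXn_modp {F : fieldType} (u : {poly F}) (m j : nat) :
  (size u <= m)%N -> (j < m)%N ->
  (('X^j * u) %% ('X^m - 1))`_m.-1 = u`_(m.-1 - j).
Proof.
move=> le_um lt_jm; have m_gt0 : (0 < m)%N by apply: leq_ltn_trans lt_jm.
set w := 'X^j * u; have sz_w : (size w <= j + m)%N.
  by rewrite (leq_trans (size_polyMleq _ _)) // size_polyXn addSn leq_add2l.
have sz_d : (size (drop_poly m w) <= j)%N.
  by rewrite size_drop_poly leq_subLR addnC.
rewrite -{1}(poly_take_drop m w).
(* Replacing ['X^m] by 1 folds the high part onto low degrees; its size is at most [j < m], so it
   misses degree [m.-1]. *)
have -> : take_poly m w + drop_poly m w * 'X^m =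
    drop_poly m w * ('X^m - 1) + (take_poly m w + drop_poly m w).
  by rewrite mulrBr mulr1 [take_poly m w + drop_poly m w]addrC addrA subrK addrC.
rewrite modp_addl_mul_small.
  rewrite coefD coef_take_poly ltn_predL m_gt0 coefXnM -subn1 ltnNge.
  rewrite leq_subRL // add1n lt_jm /=.
  rewrite [X in _ + X]nth_default ?addr0 // (leq_trans sz_d) //.
  by rewrite leq_subRL // add1n.
rewrite size_Xn_sub_1 // ltnS (leq_trans (size_polyD _ _)) // geq_max.
by rewrite size_take_poly (leq_trans sz_d) // ltnW.
Qed.

(** * Divisibility by an irreducible polynomial through a root *)

(** If [p] does not divide [r], the two are coprime, and remain so over [L], which excludes a common
    root. *)
Lemma irreducible_dvdp_root {F : fieldType} {L : fieldExtType F}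
    (p r : {poly F}) (a : L) :
  irreducible_poly p -> root (map_poly (in_alg L) p) a ->
  (p %| r) = root (map_poly (in_alg L) r) a.
Proof.
move=> p_irr pa0; apply/idP/idP => [/dvdpP[s ->] | ra0].
  by rewrite rmorphM /= rootM pa0 orbT.
apply: contraTT ra0; rewrite -irreducible_poly_coprime // => co_pr.
rewrite -(coprimep_map (in_alg L)) in co_pr.
exact: coprimep_root co_pr pa0.
Qed.

Lemma irreducible_dvdp_Xn_sub1 {F : fieldType} {L : fieldExtType F}
    (p : {poly F}) (a : L) (n : nat) :
  irreducible_poly p -> root (map_poly (in_alg L) p) a ->
  (p %| 'X^n - 1) = (a ^+ n == 1).
Proof.
move=> p_irr pa0; rewrite (irreducible_dvdp_root _ p_irr pa0).
by rewrite rmorphB rmorph1 /= map_polyXn rootE !hornerE subr_eq0.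
Qed.

Lemma XsubC1_mul_dvdp_Xn_sub1 {F : fieldType} (p : {poly F}) (n : nat) :
  p.[1] != 0 -> (('X - 1) * p %| 'X^n - 1) = (p %| 'X^n - 1).
Proof.
move=> p1; rewrite -polyC1 Gauss_dvdp; last by rewrite coprimep_sym coprimep_XsubC.
by rewrite dvdp_XsubCl rootE !hornerE expr1n subrr eqxx.
Qed.

(** * Weight of the quotient when the root is primitive *)

Section PrimitiveWeight.

Variables (F : finFieldType) (L : fieldExtType F) (k : nat).
Variables (p h : {poly F}) (a : L).
Let m := (#|F| ^ k - 1)%N.
Hypotheses (k_gt0 : (0 < k)%N) (sz_p : size p = k.+1).
Hypotheses (p_irr : irreducible_poly p) (p1 : p.[1] != 0).
Hypotheses (pa0 : root (map_poly (in_alg L) p) a) (a_prim : m.-primitive_root a).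
Hypothesis def_h : 'X^m - 1 = ('X - 1) * p * h.

Let N : {poly F} := \poly_(i < m) 1.

(* [N / p(1)] is the component of [h] modulo ['X^m - 1] on the factor ['X - 1];
   what remains is a codeword of the cyclic code with check polynomial [p]. *)
Let h' := h - p.[1]^-1 *: N.

Let m_gt0 : (0 < m)%N := prim_order_gt0 a_prim.

Let p_neq0 : p != 0. Proof. by rewrite -size_poly_eq0 sz_p. Qed.

Let mul_N : ('X - 1) * N = 'X^m - 1.
Proof.
rewrite subrX1 /N poly_def; congr (_ * _).
by apply: eq_bigr => i _; rewrite scale1r.
Qed.

Let X1_neq0 : 'X - 1 != 0 :> {poly F}.
Proof. by rewrite -polyC1 polyXsubC_eq0. Qed.

Lemma mul_check_quotient : p * h = N.
Proof. by apply: (mulfI X1_neq0); rewrite mulrA -def_h mul_N. Qed.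

(** Since [('X - 1) * N] is ['X^m - 1], multiplying [N] by [p] amounts to scaling it by [p.[1]]
    modulo ['X^m - 1], which cancels [p * h = N]. *)
Lemma dvdp_check_codeword : 'X^m - 1 %| p * h'.
Proof.
have /dvdpP[s /(canRL (subrK _)) def_p] : 'X - 1 %| p - p.[1]%:P.
  by rewrite -polyC1 dvdp_XsubCl rootE !hornerE subrr.
have pN : p * N = s * ('X^m - 1) + p.[1] *: N.
  by rewrite {1}def_p mulrDl -mulrA mul_N mul_polyC.
rewrite /h' mulrBr mul_check_quotient -scalerAr pN scalerDr scalerA.
rewrite mulVf // scale1r opprD addrCA addrN addr0.
by rewrite dvdpNr dvdpZr ?invr_eq0 // dvdp_mull.
Qed.

(** The bound [m.-1] rather than [m] matters: the coefficient of [h] in degree [m.-1] is 0, which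
    later shows that the linear form is nonzero. *)
Lemma size_quotient : (size h <= m.-1)%N.
Proof.
have P_monic : ('X - 1 : {poly F}) \is monic by rewrite -polyC1 monicXsubC.
have h_neq0 : h != 0.
  apply: contraTneq isT => h0; move/eqP: def_h.
  by rewrite h0 mulr0 -size_poly_eq0 size_Xn_sub_1.
have := congr1 (size \o polyseq) def_h; rewrite /= size_Xn_sub_1 //.
rewrite -mulrA size_monicM ?mulf_neq0 // -polyC1 size_XsubC size_mul //.
rewrite sz_p !addSn /= => -[->] /=.
by case: k k_gt0 => // k' _; rewrite addSn leq_addl.
Qed.

Lemma size_codeword : (size h' <= m)%N.
Proof.
rewrite (leq_trans (size_polyD _ _)) // geq_max size_polyN.
rewrite (leq_trans size_quotient) ?leq_pred //=.
by rewrite (leq_trans (size_scale_leq _ _)) // size_poly.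
Qed.

Lemma coef_codeword i : (i < m)%N -> h'`_i = h`_i - p.[1]^-1.
Proof. by move=> lt_im; rewrite coefB coefZ coef_poly lt_im mulr1. Qed.

Let psi (r : {poly F}) : F^o := ((r * h') %% ('X^m - 1))`_m.-1.

Let psi_linear : linear psi.
Proof.
by move=> b r s; rewrite /psi mulrDl -scalerAl modpD modpZl coefD coefZ.
Qed.

Let psi_modp r : psi (r %% p) = psi r.
Proof.
rewrite [in RHS](divp_eq r p) /psi mulrDl modpD -mulrA.
by rewrite (modp_eq0 (dvdp_mull _ dvdp_check_codeword)) add0r.
Qed.

(** The exponent is reversed so that [psi] at [row i] is the coefficient of index [i]. *)
Let row (i : 'I_m) : 'rV[F]_k := poly_rV ('X^(m.-1 - i) %% p).

Let rVpoly_row i : rVpoly (row i) = 'X^(m.-1 - i) %% p.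
Proof. by rewrite poly_rV_K // -ltnS -sz_p ltn_modpN0. Qed.

Let psi_row i : psi (rVpoly (row i)) = h'`_i.
Proof.
have le_i : (i <= m.-1)%N by rewrite -ltnS prednK.
rewrite rVpoly_row psi_modp /psi coef_mulXn_modp ?size_codeword ?subKn //.
by rewrite -[X in (_ < X)%N](prednK m_gt0) ltnS leq_subr.
Qed.

Let horner_row i : (map_poly (in_alg L) (rVpoly (row i))).[a] = a ^+ (m.-1 - i).
Proof.
rewrite rVpoly_row; set n := (m.-1 - i)%N.
have := congr1 (fun r => (map_poly (in_alg L) r).[a]) (divp_eq 'X^n p).
rewrite /= rmorphD rmorphM /= map_polyXn !hornerE (rootP pa0) mulr0 add0r.
by move->.
Qed.

Let row_inj : injective row.
Proof.
move=> i j eq_ij; apply/val_inj.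
have le_m (l : 'I_m) : (l <= m.-1)%N by rewrite -ltnS prednK.
have lt_m (l : 'I_m) : (m.-1 - l < m)%N.
  by rewrite -[X in (_ < X)%N](prednK m_gt0) ltnS leq_subr.
have /eqP := horner_row i; rewrite eq_ij horner_row.
rewrite (eq_prim_root_expr a_prim) !modn_small // => /eqP eq_s.
by rewrite /= -(subKn (le_m i)) -eq_s subKn.
Qed.

Let row_neq0 i : row i != 0.
Proof.
apply: contraTneq isT => row0; have /eqP := horner_row i.
rewrite row0 linear0 rmorph0 horner0 eq_sym expf_eq0.
by rewrite (prim_root_eq0 a_prim) eqn0Ngt m_gt0 andbF.
Qed.

(** By counting: [row] is injective into the [m] nonzero vectors. *)
Let row_surj v : v != 0 -> exists i, v = row i.
Proof.
move=> v_neq0; suff /setP/(_ v) : row @: 'I_m = [set~ 0].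
  by rewrite !inE v_neq0 => /imsetP[i _ ->]; exists i.
apply/eqP; rewrite eqEcard; apply/andP; split.
  by apply/subsetP => _ /imsetP[i _ ->]; rewrite !inE row_neq0.
by rewrite cardsC1 card_mx mul1n card_imset // card_ord /m subn1.
Qed.

Lemma card_quotient_zeros :
  (#|F| * #|[set i : 'I_m | (h`_i == 0)%R]| = #|F| ^ k)%N.
Proof.
pose f (v : 'rV[F]_k) := psi (rVpoly v).
have f_linear : linear f by move=> b u v; rewrite /f linearP psi_linear.
have lt_m1 : (m.-1 < m)%N by rewrite prednK.
(* Here [h] has coefficient 0, so the value is [- p.[1]^-1]. *)
have f_neq0 : f (row (Ordinal lt_m1)) != 0.
  rewrite /f psi_row coef_codeword //= nth_default ?size_quotient //.
  by rewrite sub0r oppr_eq0 invr_eq0.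
rewrite -(card_linear_fiber (- p.[1]^-1) f_linear f_neq0); congr (_ * _)%N.
rewrite -(card_imset _ row_inj); apply: eq_card => v; rewrite inE.
have zero_iff i : (f (row i) == - p.[1]^-1) = (h`_i == 0).
  by rewrite /f psi_row coef_codeword // -subr_eq0 opprK subrK.
apply/imsetP/idP => [[i] | fv]; first by rewrite inE -zero_iff => ? ->.
(* The zero vector is not in the fiber, which lies over a nonzero value. *)
have [i def_v] : exists i, v = row i.
  apply: row_surj; apply: contraTneq fv => ->.
  rewrite /f linear0 /psi mul0r mod0p coef0 eq_sym oppr_eq0.
  by rewrite invr_eq0.
by exists i => //; rewrite inE -zero_iff -def_v.
Qed.

Lemma nb_nonzero_coefs_quotient :
  nb_nonzero_coefs h = ((#|F| - 1) * #|F| ^ (k - 1) - 1)%N.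
Proof.
have F_gt0 : (0 < #|F|)%N by apply/card_gt0P; exists 0.
have := nb_nonzero_coefs_card (leq_trans size_quotient (leq_pred _)).
have : #|[set i : 'I_m | h`_i == 0]| = (#|F| ^ (k - 1))%N.
  apply/eqP; rewrite -(eqn_pmul2l F_gt0) card_quotient_zeros -expnS.
  by rewrite subn1 prednK.
move=> -> /(canRL (addnK _)) ->.
by rewrite /m mulnBl mul1n -expnS [in (k - 1).+1]subn1 prednK // -!subnDA addnC.
Qed.

End PrimitiveWeight.

(* If the root has order [n], then [h] is [m / n] shifted copies of the quotient
   of ['X^n - 1], so [m / n] divides both [q ^ k - 1] and the weight
   [m - q ^ (k - 1)] of [h], hence is 1. *)
Lemma primitive_root_of_weight {F : finFieldType} {L : fieldExtType F} {k : nat}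
    (p h : {poly F}) (a : L) (m := (#|F| ^ k - 1)%N) :
  (0 < k)%N -> p != 0 -> irreducible_poly p -> p.[1] != 0 ->
  root (map_poly (in_alg L) p) a -> 'X^m - 1 = ('X - 1) * p * h ->
  nb_nonzero_coefs h = ((#|F| - 1) * #|F| ^ (k - 1) - 1)%N ->
  m.-primitive_root a.
Proof.
move=> k_gt0 p_neq0 p_irr p1 pa0 def_h wt_h.
have F_gt1 : (1 < #|F|)%N := finNzRing_gt1 F.
have m_gt0 : (0 < m)%N by rewrite subn_gt0 -(exp1n k) ltn_exp2r.
have am1 : a ^+ m = 1.
  apply/eqP; rewrite -(irreducible_dvdp_Xn_sub1 _ p_irr pa0) def_h.
  by rewrite mulrAC dvdp_mull.
have [n a_prim /dvdnP[d def_m]] := prim_order_exists m_gt0 am1.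
have n_gt0 := prim_order_gt0 a_prim.
have /dvdpP[u def_u] : ('X - 1) * p %| 'X^n - 1.
  rewrite XsubC1_mul_dvdp_Xn_sub1 // (irreducible_dvdp_Xn_sub1 _ p_irr pa0).
  by rewrite prim_expr_order.
have P_neq0 : ('X - 1) * p != 0.
  by rewrite mulf_neq0 // -polyC1 polyXsubC_eq0.
have sz_u : (size u <= n)%N.
  have u_neq0 : u != 0.
    apply: contraTneq isT => u0; move/eqP: def_u.
    by rewrite u0 mul0r -size_poly_eq0 size_Xn_sub_1.
  have := congr1 (size \o polyseq) def_u; rewrite /= size_Xn_sub_1 //.
  rewrite mulrCA -polyC1 size_monicM ?monicXsubC ?mulf_neq0 // size_XsubC => -[->].
  rewrite size_mul // -subn1 -addnBA ?leq_addr //.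
  by rewrite lt0n size_poly_eq0.
have def_hu : h = u * \sum_(i < d) ('X^n) ^+ i.
  apply: (mulfI P_neq0); rewrite -def_h def_m mulnC exprM subrX1 def_u.
  by rewrite [u * _]mulrC mulrA.
have : (d %| m - #|F| ^ (k - 1))%N.
  rewrite {1}/m -subnDA addnC subnDA.
  have -> : (#|F| ^ k = #|F| * #|F| ^ (k - 1))%N.
    by rewrite -expnS subn1 prednK.
  rewrite -{2}[(#|F| ^ _)%N]mul1n -mulnBl -wt_h def_hu.
  by rewrite nb_nonzero_coefs_mul_geometric // dvdn_mulr.
have dvd_dm : (d %| m)%N by rewrite def_m dvdn_mulr.
have le_m : (#|F| ^ (k - 1) <= m)%N.
  rewrite /m leq_subRL ?expn_gt0 ?(ltnW F_gt1) // add1n ltn_exp2l //.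
  by rewrite subn1 prednK.
rewrite dvdn_subr // => dvd_dq.
suff d1 : d = 1%N by rewrite def_m d1 mul1n.
(* As [d] divides [#|F| ^ (k - 1)], it divides both [#|F| ^ k] and its predecessor [m]. *)
apply/eqP; rewrite -dvdn1; have <- : (#|F| ^ k - m = 1)%N.
  by rewrite subKn // expn_gt0 (ltnW F_gt1).
rewrite dvdn_sub // (dvdn_trans dvd_dq) // dvdn_exp2l //.
exact: leq_subr.
Qed.

Theorem theorem1 (q k : nat) (F : finFieldType) (p : {poly F})
    (hq : #|F| = q) (hk : (1 <= k)%N) (hdeg : size p = k.+1)
    (hmonic : p \is monic) (hirr : irreducible_poly p) (hp1 : p.[1] != 0) :
  let m := (q ^ k - 1)%N in
  let g : {fraction {poly F}} :=
    tofrac ('X^m - 1 : {poly F}) / tofrac (('X - 1) * p) in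
  root_primitive_poly p <->
  exists h : {poly F},
    g = tofrac h /\ nb_nonzero_coefs h = ((q - 1) * q ^ (k - 1) - 1)%N.
Proof.
move=> m g; rewrite {}/g {}/m -{}hq.
have p_neq0 : p != 0 by apply: monic_neq0.
have P_neq0 : tofrac (('X - 1) * p) != 0.
  by rewrite tofrac_eq0 mulf_neq0 // -polyC1 polyXsubC_eq0.
split=> [[_ _ [L [a []]]] | [h [/(canRL (divfK P_neq0)) /eqP]]].
  rewrite hdeg /= => _ pa0 a_prim.
  have /dvdpP[h def_h] : ('X - 1) * p %| 'X^(#|F| ^ k - 1) - 1.
    rewrite XsubC1_mul_dvdp_Xn_sub1 // (irreducible_dvdp_Xn_sub1 _ hirr pa0).
    by rewrite prim_expr_order.
  exists h; split; first by rewrite def_h tofracM mulfK.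
  by rewrite mulrC in def_h; apply: nb_nonzero_coefs_quotient pa0 a_prim def_h.
rewrite -tofracM tofrac_eq mulrC => /eqP def_h wt_h.
have m_gt0 : (0 < #|F| ^ k - 1)%N.
  by rewrite subn_gt0 -(exp1n k) ltn_exp2r // finNzRing_gt1.
split=> //.
  (* At 0, ['X^m - 1] takes the value -1 because [m] is positive. *)
  apply: contraTneq isT => p0; have := congr1 (horner^~ 0) def_h.
  rewrite !hornerE p0 expr0n eqn0Ngt m_gt0 mulr0 mul0r sub0r => /eqP.
  by rewrite oppr_eq0 oner_eq0.
have [L dimL [a pa0 _]] := irredp_FAdjoin hirr.
exists L, a; split=> //; rewrite hdeg.
exact: primitive_root_of_weight pa0 def_h wt_h.
Qed.
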